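(* Let $\kappa$ be an infinite cardinal, let $X$ be a set of cardinality $|X|=\kappa^+$, and let $\langle\cdot\rangle:\mathcal P_X\to\mathcal P_X$ be a hull operator with finite supports and the MacLane-Steinitz exchange property. If $|\langle F\rangle\setminus\langle\varnothing\rangle|\le\kappa$ for each finite subset $F\subset X$, then the set $X\setminus\langle\varnothing\rangle$ can be covered by $\kappa$ many independent subsets.
   Context: $\mathcal P_X$ denotes the power set of $X$, and $\kappa^+$ is the successor cardinal of $\kappa$. A hull operator on a set $X$ is any function $\langle\cdot\rangle:\mathcal P_X\to\mathcal P_X$ such that $A\subset\langle A\rangle\subset\langle B\rangle$ for any subsets $A\subset B$ of $X$ (idempotence is not part of the definition). A subset $A\subset X$ is independent (with respect to $\langle\cdot\rangle$) if $a\notin\langle A\setminus\{a\}\rangle$ for every $a\in A$. The hull operator has finite supports if for each $A\subset X$ and $a\in\langle A\rangle$ there is a finite subset $F\subset A$ with $a\in\langle F\rangle$. It has the MacLane-Steinitz exchange property if for any subset $A\subset X$ and points $x,y\in X\setminus\langle A\rangle$ the inclusion $x\in\langle A\cup\{y\}\rangle$ is equivalent to $y\in\langle A\cup\{x\}\rangle$. *)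

(* Defs.v *)
From mathcomp Require Import all_boot.
From mathcomp Require Import boolp classical_sets functions cardinality.

Set Implicit Arguments.
Unset Strict Implicit.
Unset Printing Implicit Defensive.

Local Open Scope classical_set_scope.
Local Open Scope card_scope.

Definition card_lt (T U : Type) : Prop :=
  [set: T] #<= [set: U] /\ ~ ([set: U] #<= [set: T]).

(* A cardinal is represented by any type of that cardinality. This says that
   |X| = |K|^+, i.e. |X| is the least cardinal greater than |K|. *)
Definition has_successor_card (K X : Type) : Prop :=
  card_lt K X /\ forall Y : Type, card_lt K Y -> [set: X] #<= [set: Y].

Definition hull_operator (X : Type) (h : set X -> set X) : Prop :=
  forall A B : set X, A `<=` B -> A `<=` h A /\ h A `<=` h B.

Definition independent (X : Type) (h : set X -> set X) (A : set X) : Prop :=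
  forall a, A a -> ~ h (A `\ a) a.

Definition finite_supports (X : Type) (h : set X -> set X) : Prop :=
  forall (A : set X) (a : X), h A a ->
    exists F : set X, [/\ finite_set F, F `<=` A & h F a].

Definition exchange_property (X : Type) (h : set X -> set X) : Prop :=
  forall (A : set X) (x y : X), ~ h A x -> ~ h A y ->
    (h (A `|` [set y]) x <-> h (A `|` [set x]) y).

(* Main.v *)
Require Import Defs.
From mathcomp Require Import all_boot.
From mathcomp Require Import boolp classical_sets functions cardinality.
From mathcomp Require Import wochoice.
Local Open Scope classical_set_scope.
Local Open Scope card_scope.

Set Implicit Arguments.
Unset Strict Implicit.
Unset Printing Implicit Defensive.

(** Write [Y] for the complement of [h set0] and call a subset [Z] of [Y]
closed when it contains [h F `\` h set0] for every finite [F] included in [Z].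
Since [X] has cardinality the successor of [K], it carries a well-order all of
whose initial segments have at most [K] elements ([successor_well_order]), and
the closure of a set of at most [K] elements still has at most [K] elements
([card_le_hull_closure]).  Closing up the initial segments thus yields an
increasing family of closed sets [Z x], each of size at most [K], that
exhausts [Y].  The rank of [y] is the least [x] with [y] in [Z x].

Colour [y] by its image under an injection of [Z (rank y)] into [K].
Distinct points of the same colour have different ranks, and this makes every colour
class independent ([independent_of_rank]): if [F] is finite in the class, all
elements of [F] have rank at most some [w], and [b] in the class lies in [h F],
then [b] has rank at most [w] because [Z w] is closed.  So the point of top
rank in a finite subset of the class is never in the hull of the others.  The
exchange property reduces the case of an arbitrary point to this one.

The cardinal arithmetic rests on two consequences of Zorn's lemma: any two
cardinals are comparable ([card_le_total]), and an infinite [K] has as many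
finite words over it as elements ([card_le_seq]).  The latter contains
[K * K = K] and bounds unions of at most [K] sets of size at most [K] as well
as the number of finite subsets. *)

(** * Comparability of cardinals *)

Lemma total_on_bigcup2 T (F : set (set T)) (x y : T) :
  total_on F subset -> (\bigcup_(G in F) G) x -> (\bigcup_(G in F) G) y ->
  exists G, [/\ F G, G x & G y].
Proof.
move=> Ftot [G FG Gx] [H FH Hy].
by have [GH|HG] := Ftot G H FG FH; [exists H|exists G]; split=> //; auto.
Qed.

(** A set of pairs rather than a function, so that Zorn's lemma for inclusion
applies and unions of chains come for free. *)
Definition partial_injection T U (G : set (T * U)) :=
  forall p q, G p -> G q -> p.1 = q.1 <-> p.2 = q.2.

Lemma partial_injection_bigcup T U (F : set (set (T * U))) :
  (forall G, F G -> partial_injection G) -> total_on F subset ->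
  partial_injection (\bigcup_(G in F) G).
Proof.
move=> Finj Ftot p q Fp Fq.
by have [G [FG Gp Gq]] := total_on_bigcup2 Ftot Fp Fq; apply: (Finj G).
Qed.

(** A maximal partial injection from [A] to [B] is total or onto: otherwise one
more pair can be added to it. *)
Lemma card_le_total T U (A : set T) (B : set U) : A #<= B \/ B #<= A.
Proof.
elim/Ppointed: T => T in A *; first by left; rewrite ?emptyE.
elim/Ppointed: U => U in B *; first by right; rewrite ?emptyE.
have [|G [[GAB Ginj] Gmax]] := @Zorn_bigcup _
    [set G : set (T * U) | G `<=` A `*` B /\ partial_injection G].
  move=> F FP Ftot; split.
    by move=> p [G FG Gp]; have [+ _] := FP _ FG; apply.
  by apply: partial_injection_bigcup => // G /FP[].
have [Adom|/existsNP[a /not_implyP[Aa aG]]] :=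
    pselect (forall a, A a -> exists b, G (a, b)).
  left; have /choice[f fG] : forall a, exists b, A a -> G (a, b).
    by move=> a; case: (pselect (A a)) => [/Adom[b]|?]; [exists b|exists point].
  apply/pcard_leP/injfunPex; exists f.
    by move=> a Aa; have [] := GAB _ (fG _ Aa).
  move=> a a' /set_mem Aa /set_mem Aa' ff.
  exact/(Ginj _ _ (fG _ Aa) (fG _ Aa')).
have [Bran|/existsNP[b /not_implyP[Bb bG]]] :=
    pselect (forall b, B b -> exists a, G (a, b)).
  right; have /choice[g gG] : forall b, exists a, B b -> G (a, b).
    by move=> b; case: (pselect (B b)) => [/Bran[c]|?]; [exists c|exists point].
  apply/pcard_leP/injfunPex; exists g.
    by move=> b Bb; have [] := GAB _ (gG _ Bb).
  move=> b b' /set_mem Bb /set_mem Bb' gg.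
  exact/(Ginj _ _ (gG _ Bb) (gG _ Bb')).
exfalso; apply: (Gmax (G `|` [set (a, b)])).
  split; first by move=> p Gp; left.
  by move=> /(_ (a, b) (or_intror erefl)) Gab; apply: aG; exists b.
split; first by move=> p [/GAB//|->].
move=> [x y] [x' y'] [Gp|[-> ->]] [Gq|[-> ->]] /=; first exact: Ginj Gp Gq.
- split=> e; [case: aG|case: bG]; last by exists x; rewrite -e.
  by exists y; rewrite -e.
- split=> e; [case: aG|case: bG]; last by exists x'; rewrite e.
  by exists y'; rewrite e.
- by [].
Qed.

(** * Finite words over an infinite set *)

Definition words (K : eqType) (D : set K) : set (seq K) :=
  [set s | s <> [::] /\ forall k, k \in s -> D k].

(** The letters are recovered from the graph by looking at the one-letter words
in its domain; thus a code is a mere set of pairs, ordered by inclusion. *)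
Definition alphabet (K : Type) (G : set (seq K * K)) : set K :=
  [set k | exists z, G ([:: k], z)].

(** The graph of an injection of [words D] into [D], with [D] its alphabet.  The
empty word is left out of [words], so that the empty graph is a code and the
empty chain needs no special care. *)
Definition word_code (K : eqType) (G : set (seq K * K)) :=
  [/\ partial_injection G,
      forall s z, G (s, z) -> alphabet G z
    & forall s, (exists z, G (s, z)) <-> words (alphabet G) s].

(** A word over the alphabet of the union has finitely many letters, so it is a
word over the alphabet of some member of the chain. *)
Lemma word_code_bigcup (K : eqType) (F : set (set (seq K * K))) :
  F `<=` @word_code K -> total_on F subset ->
  word_code (\bigcup_(G in F) G).
Proof.
move=> Fcode Ftot.
have alpha k : alphabet (\bigcup_(G in F) G) k <->
    exists2 G, F G & alphabet G k.
  split=> [[z [G FG Gz]]|[G FG [z Gz]]]; first by exists G => //; exists z.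
  by exists z, G.
split.
- by apply: partial_injection_bigcup => // G /Fcode[].
- move=> s z [G FG Gsz]; apply/alpha; exists G => //.
  by have [_ + _] := Fcode _ FG; apply; exact: Gsz.
- move=> s; split=> [[z [G FG Gsz]]|[s0 sF]].
    have [_ _ /(_ s)[+ _]] := Fcode _ FG.
    case=> [|s0 sG]; first by exists z.
    by split=> // k /sG ?; apply/alpha; exists G.
  have [G FG sG] : exists2 G, F G & forall k, k \in s -> alphabet G k.
    elim: s s0 sF => [//|k s IH _ sF].
    have /alpha[G FG Gk] := sF k (mem_head k s).
    have [->|/eqP s0] := eqVneq s [::].
      by exists G => // l; rewrite inE => /eqP ->.
    have [//|l ls|H FH sH] := IH; first by apply: sF; rewrite inE ls orbT.
    have [GH|HG] := Ftot G H FG FH.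
      exists H => // l; rewrite inE => /predU1P[->|]; last exact: sH.
      by have [z Gz] := Gk; exists z; apply: GH.
    exists G => // l; rewrite inE => /predU1P[->//|/sH[z Hz]].
    by exists z; apply: HG.
  have [_ _ /(_ s)[_ []//]] := Fcode _ FG.
  by move=> z Gz; exists z, G.
Qed.

Lemma card_le_setT_inj (T U : Type) (B : set U) : [set: T] #<= B ->
  exists2 f : T -> U, injective f & forall x, B (f x).
Proof.
move=> /card_leP[f]; exists (fun x => val (f (SigSub (mem_set (I : setT x))))).
  move=> x y /val_inj.
  by move=> /(@inj _ _ _ f _ _ (mem_set I) (mem_set I))[].
by move=> x; apply: set_valP.
Qed.

Lemma word_code_nonempty (K : eqType) :
  infinite_set [set: K] -> exists2 G : set (seq K * K), word_code G & G !=set0.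
Proof.
move=> /infiniteP/card_le_setT_inj[i iI _].
pose G : set (seq K * K) :=
  [set p | exists2 s : seq nat, s <> [::] & p = (map i s, i (pickle s))].
have alpha k : alphabet G k <-> exists n, k = i n.
  split=> [[z [[//|n [|//]] _ [-> _]]]|[n ->]]; first by exists n.
  by exists (i (pickle [:: n])); exists [:: n].
exists G; last by exists ([:: i 0], i (pickle [:: 0])); exists [:: 0].
split.
- move=> _ _ [s s0 ->] [t t0 ->] /=; split=> [/(inj_map iI) -> //|].
  by move=> /iI /(pcan_inj pickleK) ->.
- by move=> s z [t _ [_ ->]]; apply/alpha; eexists.
- move=> s; split=> [[z [t t0 [-> _]]]|[s0 si]].
    split; first by case: t t0.
    by move=> k /mapP[n _ ->]; apply/alpha; exists n.
  have [t st] : exists t, s = map i t.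
    elim: s si {s0} => [_|k s IH si]; first by exists [::].
    have /alpha[n ->] := si k (mem_head k s).
    have [k' k's|t ->] := IH; first by apply: si; rewrite inE k's orbT.
    by exists (n :: t).
  by exists (i (pickle t)), t; rewrite -?st//; case: t st s0 => // ->.
Qed.

Lemma word_code_fun (K : pointedType) (G : set (seq K * K)) : word_code G ->
  exists f : seq K -> K, [/\ forall s, words (alphabet G) s -> G (s, f s),
    forall s, words (alphabet G) s -> alphabet G (f s)
    & {in words (alphabet G) &, injective f}].
Proof.
move=> [Ginj Gran Gdom].
have /choice[f fG] : forall s, exists z, words (alphabet G) s -> G (s, z).
  move=> s; have [/Gdom[z Gz]|nw] := pselect (words (alphabet G) s).
    by exists z.
  by exists point.
exists f; split=> // [s /fG/Gran//|s t /set_mem sw /set_mem tw].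
exact: (Ginj (s, _) (t, _) (fG _ sw) (fG _ tw)).2.
Qed.

(** Two copies of the alphabet fit into it: a letter [k] becomes the code of the
word [k], while an extra letter, paired with the letter [e k], becomes the code
of the word [e k, e k]. *)
Lemma word_code_double (K : pointedType) (G : set (seq K * K)) (E : set K) :
  word_code G -> (forall k, E k -> ~ alphabet G k) -> E #<= alphabet G ->
  exists2 d : K -> K,
    forall k, (alphabet G `|` E) k -> alphabet G (d k) &
    {in alphabet G `|` E &, injective d}.
Proof.
move=> /word_code_fun; set D := alphabet G.
move=> [f [_ fD fI]] ED /pcard_leP/injfunPex[e eD eI].
pose w k := if `[< D k >] then [:: k] else [:: e k; e k].
have wD k : (D `|` E) k -> words D (w k).
  move=> DEk; split; first by rewrite /w; case: ifP.
  rewrite /w => x; case: asboolP => [Dk|nDk]; rewrite !inE ?orbb.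
    by move=> /eqP->.
  by case: DEk => [//|Ek] /eqP->; exact: eD.
exists (f \o w) => [k DEk|k l /set_mem DEk /set_mem DEl /= ff].
  by apply: fD; exact: wD.
have : w k = w l by apply: fI ff; apply/mem_set; exact: wD.
rewrite /w; case: asboolP => Dk; case: asboolP => Dl //; first by case.
by case: DEk DEl => // Ek [//|El] [] ekl _; apply: eI ekl; exact/mem_set.
Qed.

(** If [g] embeds the alphabet [D] into its complement, the letters [B := g @` D]
can be added: words over [D `|` B] that involve a new letter are sent into [B],
by translating them to words over [D], coding these, and applying [g]. *)
Lemma word_code_extend (K : pointedType) (G : set (seq K * K)) :
  word_code G -> alphabet G !=set0 -> alphabet G #<= ~` alphabet G ->
  exists2 G' : set (seq K * K), G `<` G' & word_code G'.
Proof.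
move=> Gcode; have [f [fG fD fI]] := word_code_fun Gcode.
have double := word_code_double Gcode; case: Gcode => Ginj Gran Gdom.
set D := alphabet G in Gran Gdom fG fD fI double *.
move=> [a Da] /pcard_leP/injfunPex[g gC gI].
have [||d dD dI] := double (g @` D); first by move=> _ [k Dk <-]; exact: gC.
  exact: card_image_le.
pose B := g @` D.
pose new s := words (D `|` B) s /\ exists2 k, k \in s & B k.
have newd s : new s -> words D (map d s).
  move=> [[s0 sDB] _]; split; first by case: s s0 {sDB}.
  by move=> _ /mapP[k /sDB ks ->]; exact: dD.
pose G' := G `|` [set p | new p.1 /\ p.2 = g (f (map d p.1))].
have BD k : B k -> ~ D k by move=> [x Dx <-]; exact: gC.
have new1 k : B k -> new [:: k].
  move=> Bk; split; last by exists k; rewrite ?inE.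
  by split=> // l; rewrite inE => /eqP ->; right.
have newB s : new s -> B (g (f (map d s))).
  by move=> /newd/fD ?; exists (f (map d s)).
have newN s z : new s -> ~ G (s, z).
  move=> [_ [k ks Bk]] Gs; have /Gdom[_ sD] : exists z, G (s, z) by exists z.
  exact: BD Bk (sD _ ks).
have alpha k : alphabet G' k <-> (D `|` B) k.
  split=> [[z [Gz|[[[_ kDB] _] _]]]|[[z Gz]|Bk]].
  - by left; exists z.
  - by apply: kDB; rewrite inE.
  - by exists z; left.
  - by exists (g (f (map d [:: k]))); right; split=> //; exact: new1.
exists G'.
  split; first by move=> p; left.
  move=> G'G; suff : D (g a) by exact: gC.
  exists (g (f (map d [:: g a]))); apply: G'G; right; split=> //.
  by apply: new1; exists a.
split.
- move=> [s z] [t y] [Gs|[/= ns ->]] [Gt|[/= nt ->]] /=.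
  + exact: Ginj Gs Gt.
  + split=> e; first by case: (newN t z nt); rewrite -e.
    by case: (BD _ (newB _ nt)); rewrite -e; exact: Gran Gs.
  + split=> e; first by case: (newN s y ns); rewrite e.
    by case: (BD _ (newB _ ns)); rewrite e; exact: Gran Gt.
  + split=> [-> //|e].
    have fst : f (map d s) = f (map d t).
      by apply: gI e; apply/mem_set/fD/newd.
    have : map d s = map d t by apply: fI fst; apply/mem_set/newd.
    have [[_ sDB] _] := ns; have [[_ tDB] _] := nt.
    by apply: (inj_in_map dI); apply/allP => k ?; apply/mem_set; auto.
- move=> s z [/Gran Dz|[/= ns ->]]; apply/alpha; first by left.
  by right; exact: newB.
- move=> s; split=> [[z [Gs|[/= [[s0 sDB] _] _]]]|[s0 sDB]].
  + have /Gdom[s0 sD] : exists z, G (s, z) by exists z.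
    by split=> // k /sD ?; apply/alpha; left.
  + by split=> // k /sDB ?; apply/alpha.
  + have [ex|nex] := pselect (exists2 k, k \in s & B k).
      exists (g (f (map d s))); right; split=> //; split=> //; split=> // k.
      by move=> /sDB/alpha.
    have /Gdom[z Gz] : words D s.
      split=> // k ks; have /alpha[//|Bk] := sDB _ ks.
      by case: nex; exists k.
    by exists z; left.
Qed.

(** A maximal word code has an alphabet [D] that does not embed into its
complement; by comparability the complement embeds into [D], hence so does [K],
and words over [K] can be translated to words over [D] and coded there. *)
Lemma card_le_seq (K : Type) :
  infinite_set [set: K] -> [set: seq K] #<= [set: K].
Proof.
elim/Ppointed: K => K Kinf.
  by case: Kinf; rewrite emptyE; apply: finite_set0.
have [G [Gcode Gmax]] := Zorn_bigcup (@word_code_bigcup K).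
have [_ Gran _] := Gcode.
have D0 : alphabet G !=set0.
  apply: contrapT => /nonemptyPn D0.
  have [G0 G0code [p G0p]] := word_code_nonempty Kinf.
  have GN s z : ~ G (s, z) by move=> /Gran; rewrite D0.
  apply: (Gmax G0) G0code; split=> [[s z] /GN//|].
  by case: p G0p => s z G0p /(_ _ G0p)/GN.
have [/(word_code_extend Gcode D0)[G' GG' G'code]|CD] :=
    card_le_total (alphabet G) (~` alphabet G).
  by case: (Gmax G' GG').
have [//|d dD dI] := word_code_double Gcode _ CD.
have all k : (alphabet G `|` ~` alphabet G) k by rewrite setUv.
have {}dI : injective d by move=> k l; apply: dI; exact/mem_set.
have [f [_ _ fI]] := word_code_fun Gcode.
(* The letter [point] is prepended to avoid the empty word. *)
have dW s : words (alphabet G) (map d (point :: s)).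
  by split=> // k /mapP[l _ ->]; exact: dD.
apply/pcard_injP; exists (fun s => f (map d (point :: s))) => s t _ _ fst.
have /(inj_map dI)[//] : map d (point :: s) = map d (point :: t).
by apply: fI fst; exact/mem_set.
Qed.

(** * Sets of bounded cardinality *)

(** A point of the union is coded by the two-letter word formed by the code of
a set that contains it and its code in that set. *)
Lemma card_le_bigcup (K I T : Type) (D : set I) (F : I -> set T) :
  infinite_set [set: K] -> D #<= [set: K] ->
  (forall i, D i -> F i #<= [set: K]) ->
  \bigcup_(i in D) F i #<= [set: K].
Proof.
move=> /[dup] Kinf; elim/Ppointed: K => K in Kinf *.
  by case: Kinf; rewrite emptyE; apply: finite_set0.
move=> /card_le_seq/pcard_injP[c /in2TT cI] /pcard_injP[f fI] FK.
elim/Ppointed: I => I in D F f fI FK *.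
  by rewrite (_ : \bigcup_(i in D) F i = set0) ?card_ge0// emptyE bigcup_set0.
have /choice[g gI] : forall i, exists g : T -> K, D i -> {in F i &, injective g}.
  move=> i; have [/FK/pcard_injP[g gI]|nDi] := pselect (D i); first by exists g.
  by exists (fun=> point).
have /choice[i iF] : forall t, exists i, (\bigcup_(i in D) F i) t -> D i /\ F i t.
  move=> t; have [[i Di Fit]|nt] := pselect ((\bigcup_(i in D) F i) t).
    by exists i.
  by exists point.
apply/pcard_injP; exists (fun t => c [:: f (i t); g (i t) t]) => t u.
move=> /set_mem/iF[Dt Ft] /set_mem/iF[Du Fu] /cI[fitu].
have itu : i t = i u by apply: fI fitu; exact/mem_set.
rewrite {}itu in Ft *; apply: (gI _ Du); exact/mem_set.
Qed.

Lemma card_le_finite_infinite (K T : Type) (A : set T) :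
  infinite_set [set: K] -> finite_set A -> A #<= [set: K].
Proof.
move=> /infiniteP Kinf /finite_set_countable Acount.
exact: card_le_trans Acount Kinf.
Qed.

Lemma card_le_setU (K T : Type) (A B : set T) :
  infinite_set [set: K] -> A #<= [set: K] -> B #<= [set: K] ->
  A `|` B #<= [set: K].
Proof.
move=> Kinf AK BK; rewrite -bigcup2E; apply: card_le_bigcup => //.
  exact/infiniteP.
by move=> [|[|n]] _ //=; apply: card_ge0.
Qed.

Lemma card_le_finite_subsets (K T : Type) (Z : set T) :
  infinite_set [set: K] -> Z #<= [set: K] ->
  [set F : set T | finite_set F /\ F `<=` Z] #<= [set: K].
Proof.
elim/Pchoice: T => T in Z *.
move=> /[dup] Kinf; elim/Ppointed: K => K in Kinf *.
  by case: Kinf; rewrite emptyE; apply: finite_set0.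
move=> /card_le_seq/pcard_injP[c /in2TT cI] /pcard_injP[f fI].
have /choice[s sE] : forall F : set T, exists s : seq T,
    finite_set F -> F = [set` s].
  move=> F; have [/finite_seqP[s Fs]|nF] := pselect (finite_set F).
    by exists s.
  by exists [::].
apply/pcard_injP; exists (fun F => c (map f (s F))).
have sub F G : finite_set F /\ F `<=` Z -> finite_set G /\ G `<=` Z ->
    map f (s F) = map f (s G) -> F `<=` G.
  move=> [Ffin FZ] [Gfin GZ] FG t Ft; rewrite (sE G Gfin) /=.
  have /(map_f f) : t \in s F by move: Ft; rewrite {1}(sE F Ffin).
  rewrite FG => /mapP[u us /fI tu].
  rewrite tu //; first exact/mem_set/FZ.
  by apply/mem_set/GZ; rewrite (sE G Gfin).
move=> F G /set_mem FP /set_mem GP /cI FG.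
by apply/seteqP; split; exact: sub.
Qed.

Lemma finite_sub_bigcup_nondecreasing (T : Type) (C : nat -> set T) (F : set T) :
  (forall m n, m <= n -> C m `<=` C n) -> finite_set F ->
  F `<=` \bigcup_n C n -> exists n, F `<=` C n.
Proof.
elim/Pchoice: T => T in C F * => Cmono /finite_seqP[s ->].
elim: s => [|x s IH] sC; first by exists 0.
have [n nx] : exists n, C n x by have [n _] := sC x (mem_head x s); exists n.
have [y ys|m ms] := IH; first by apply: sC; rewrite /= inE ys orbT.
exists (maxn m n) => y; rewrite /= inE => /predU1P[->|/ms].
  exact: Cmono (leq_maxr m n) _ nx.
exact: Cmono (leq_maxl m n) _.
Qed.

(** * Closed sets for a hull operator *)

Section HullClosure.
Variables (X : Type) (h : set X -> set X).

Definition hull_step (Z : set X) : set X :=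
  \bigcup_(F in [set F | finite_set F /\ F `<=` Z]) (h F `\` h set0).

(** When [Z] avoids [h set0], this is the least superset of [Z] that contains
[h F `\` h set0] for all its finite subsets [F]; as [h] is not idempotent, the
step must be iterated. *)
Definition hull_closure (Z : set X) : set X :=
  \bigcup_n iter n hull_step Z.

Lemma hull_step_mono Z Z' : Z `<=` Z' -> hull_step Z `<=` hull_step Z'.
Proof.
by move=> ZZ' x [F [Ffin FZ] Fx]; exists F => //; split=> // y /FZ/ZZ'.
Qed.

Lemma hull_closure_mono Z Z' :
  Z `<=` Z' -> hull_closure Z `<=` hull_closure Z'.
Proof.
move=> ZZ' x [n _ nx]; exists n => //.
by elim: n x nx => [|n IH] x; [exact: ZZ'|exact: hull_step_mono].
Qed.

Lemma sub_hull_closure Z : Z `<=` hull_closure Z.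
Proof. by move=> x Zx; exists 0. Qed.

Hypothesis h_hull : hull_operator h.

(** The restriction to [~` h set0] makes the iterates of [hull_step] increase:
a step discards the points of [h set0]. *)
Lemma sub_hull_step (Z : set X) : Z `<=` ~` h set0 -> Z `<=` hull_step Z.
Proof.
move=> Z0 x Zx; exists [set x]; first by split; [exact: finite_set1|move=> _ ->].
split; last exact: Z0.
by have [+ _] := h_hull (@subset_refl _ [set x]); apply.
Qed.

Lemma iter_hull_step_sub (Z : set X) m n : Z `<=` ~` h set0 -> m <= n ->
  iter m hull_step Z `<=` iter n hull_step Z.
Proof.
move=> Z0; have S k : iter k hull_step Z `<=` iter k.+1 hull_step Z.
  apply: sub_hull_step; case: k => [//|k].
  by move=> x [F _ []].
elim: n => [|n IH]; first by rewrite leqn0 => /eqP->.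
rewrite leq_eqVlt => /predU1P[->//|]; rewrite ltnS => /IH mn x /mn.
exact: S.
Qed.

Lemma hull_closureP (Z F : set X) : Z `<=` ~` h set0 ->
  finite_set F -> F `<=` hull_closure Z -> h F `\` h set0 `<=` hull_closure Z.
Proof.
move=> Z0 Ffin FZ x Fx.
have [m n|n Fn] := finite_sub_bigcup_nondecreasing _ Ffin FZ.
  exact: iter_hull_step_sub.
by exists n.+1 => //; exists F.
Qed.

Lemma card_le_hull_closure (K : Type) (Z : set X) :
  infinite_set [set: K] ->
  (forall F, finite_set F -> h F `\` h set0 #<= [set: K]) ->
  Z #<= [set: K] -> hull_closure Z #<= [set: K].
Proof.
move=> Kinf h_small ZK; apply: card_le_bigcup => //; first exact/infiniteP.
move=> n _; elim: n => [//|n IH]; apply: card_le_bigcup => //.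
  exact: card_le_finite_subsets.
by move=> F [/h_small].
Qed.
End HullClosure.

(** * Well-orders with small initial segments *)

Section WellOrder.
Variables (T : eqType) (R : rel T).
Hypothesis Rwo : well_order R.

Lemma well_order_total : total R.
Proof. by move=> x y; apply: (wo_chainW (withinW Rwo)). Qed.

Lemma well_order_refl : reflexive R.
Proof. by move=> x; have := well_order_total x x; rewrite orbb. Qed.

Lemma well_order_anti : antisymmetric R.
Proof. by move=> x y; apply: (wo_chain_antisymmetric (withinW Rwo)). Qed.

Lemma well_order_trans : transitive R.
Proof.
move=> y x z xy yz.
have [|m [[]]] := Rwo (A := [mem [:: x; y; z]]); first by exists x; apply: mem_head.
move=> + mle _; rewrite !inE => /or3P[]/eqP mE; rewrite {}mE in mle.
- by apply: mle; rewrite !inE eqxx !orbT.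
- by rewrite (@well_order_anti x y)// xy mle// !inE eqxx.
- by rewrite -(@well_order_anti y z)// yz mle// !inE eqxx orbT.
Qed.
End WellOrder.

(** Take any well-order.  If some strict initial segment is as large as [T], let
[m] bound the least such segment and transport to [T] the order of that segment
along an injection [f] into it: as [f x] precedes [m], the segment below [f x]
is too small for [T]. *)
Lemma initial_well_order (T : eqType) : exists R : rel T,
  well_order R /\ forall x, ~ ([set: T] #<= [set y | R y x && (y != x)]).
Proof.
have [R Rwo] := well_ordering_principle T.
pose big := [pred x | `[< [set: T] #<= [set y | R y x && (y != x)] >]].
have [bigN0|nbig] := pselect (nonempty big); last first.
  by exists R; split=> // x xbig; apply: nbig; exists x; apply/asboolP.
have [m [[/asboolP/card_le_setT_inj[f fI fm] mmin _]]] := Rwo big bigN0.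
exists (fun x y => R (f x) (f y)); split.
  apply: antisymmetric_well_order; first by move=> x y /(well_order_anti Rwo)/fI.
  move=> A [a aA].
  have [|z [[/asboolP[b bA <-] bmin] _]] :=
      Rwo [pred y | `[< exists2 x, x \in A & f x = y >]].
    by exists (f a); apply/asboolP; exists a.
  by exists b; split=> // x xA; apply: bmin; apply/asboolP; exists x.
move=> x xbig; have /andP[Rxm /eqP[]] := fm x.
apply: (well_order_anti Rwo); rewrite Rxm mmin//; apply/asboolP.
apply: card_le_trans xbig _.
rewrite -(card_le_eql (inj_card_eq (in2W fI))).
apply: subset_card_le => _ [y /andP[yx yNx] <-] /=.
by rewrite yx (inj_eq fI).
Qed.

(** An initial segment that [X] does not embed into has at most [K] elements,
for [X] is the least cardinal above [K]. *)
Lemma successor_well_order (K : Type) (X : eqType) :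
  infinite_set [set: K] -> has_successor_card K X ->
  exists R : rel X, well_order R /\ forall x, [set y | R y x] #<= [set: K].
Proof.
move=> Kinf [_ Xmin]; have [R [Rwo Rinit]] := initial_well_order X.
exists R; split=> // x; set S := [set y | R y x && (y != x)].
have SK : S #<= [set: K].
  apply: contrapT => nSK; apply: (Rinit x).
  rewrite -/S -(card_le_eqr (card_setT S)).
  apply: Xmin; split; last by rewrite (card_le_eql (card_setT S)).
  by rewrite (card_le_eqr (card_setT S)); case: (card_le_total S [set: K]).
have xK := card_le_finite_infinite Kinf (finite_set1 x).
apply: card_le_trans (card_le_setU Kinf SK xK).
apply: subset_card_le => y /= yx.
by have [->|yNx] := eqVneq y x; [right|left; apply/andP].
Qed.

(** * Independence and the covering *)

(** A point of [A] whose rank bounds those of finitely many others is not in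
their hull: by the hypothesis on ranks, its rank would be that of one of them,
against injectivity.
For an arbitrary point [a] in the hull of a finite [t], with [b] of top rank in
[t], induct on the size of [t]: neither [a] nor [b] is in the hull of [u], which
is [t] without [b], so by exchange [b] is in the hull of [u] and [a], where it
has top rank. *)
Lemma independent_of_rank (X : Type) (W : eqType) (R : rel W)
    (h : set X -> set X) (r : X -> W) (A : set X) :
  well_order R -> finite_supports h -> exchange_property h ->
  (forall F w, finite_set F -> F `<=` ~` h set0 -> (forall x, F x -> R (r x) w) ->
    forall y, h F y -> ~ h set0 y -> R (r y) w) ->
  A `<=` ~` h set0 -> {in A &, injective r} -> independent h A.
Proof.
elim/Pchoice: X => X in h r A *.
move=> Rwo h_fin h_exch hr A0 rI.
have Rtot := well_order_total Rwo; have Rtr := well_order_trans Rwo.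
have maxs a (s : seq X) : exists2 b, b \in a :: s &
    forall c, c \in a :: s -> R (r c) (r b).
  elim: s a => [a|b s IH a].
    exists a; first exact: mem_head.
    by move=> c; rewrite inE => /eqP ->; apply: well_order_refl.
  have [c cs cmax] := IH b; case/orP: (Rtot (r a) (r c)) => ac.
    exists c; first by rewrite inE cs orbT.
    by move=> d; rewrite inE => /predU1P[->|/cmax].
  exists a; first exact: mem_head.
  move=> d; rewrite inE => /predU1P[->|/cmax dc]; first exact: well_order_refl.
  exact: Rtr ac.
have top (s : seq X) b : (forall c, c \in s -> A c) -> A b -> b \notin s ->
    (forall c, c \in s -> R (r c) (r b)) -> ~ h [set` s] b.
  case: s => [|a s] sA Ab bs sb hb.
    by apply: (A0 b Ab); rewrite set_nil in hb.
  have [c cs cmax] := maxs a s.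
  have bc : R (r b) (r c).
    by apply: (hr [set` a :: s]) => //; [move=> x /sA/A0|exact: A0].
  move: bs; rewrite (_ : b = c) ?cs//; apply: rI; rewrite ?inE//; first exact: sA.
  by apply: (well_order_anti Rwo); rewrite bc sb.
have main n (s : seq X) a : size s <= n -> (forall c, c \in s -> A c) -> A a ->
    a \notin s -> ~ h [set` s] a.
  elim: n s a => [|n IH] s a sn sA Aa aNs.
    by apply: top => // c; case: s sn {sA aNs}.
  case: s sn sA aNs => [|x s] sn sA aNs; first exact: top.
  have [b bs bmax] := maxs x s; set t := x :: s in sn sA aNs bs bmax *.
  case/orP: (Rtot (r b) (r a)) => [ba|ab].
    by apply: top => // c /bmax cb; exact: Rtr ba.
  pose u := filter (predC1 b) t.
  have un : size u <= n.
    rewrite -ltnS (leq_trans _ sn)// size_filter -[leqRHS](count_predC (pred1 b)).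
    by rewrite -[leqLHS]add1n leq_add2r -has_count has_pred1.
  have uA c : c \in u -> A c by rewrite mem_filter => /andP[_ /sA].
  have aNu : a \notin u by rewrite mem_filter (negPf aNs) andbF.
  have bNu : b \notin u by rewrite mem_filter /= eqxx.
  have tE : [set` t] = [set` u] `|` [set b].
    apply/seteqP; split=> c /=.
      by have [->|cb] := eqVneq c b; [right|left; rewrite /= mem_filter /= cb].
    by case=> [|->//]; rewrite /= mem_filter => /andP[].
  rewrite tE => /(h_exch _ _ _ (IH _ _ un uA Aa aNu) (IH _ _ un uA (sA _ bs) bNu)).
  have -> : [set` u] `|` [set a] = [set` a :: u].
    apply/seteqP; split=> c; rewrite /= inE; last first.
      by case/predU1P; [right|left].
    by case=> ->; rewrite ?eqxx ?orbT.
  apply: top; rewrite ?inE.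
  - by move=> c; rewrite inE => /predU1P[->//|/uA].
  - exact: sA.
  - by rewrite negb_or bNu andbT; apply: contraNneq aNs => <-.
  - by move=> c; rewrite inE => /predU1P[->//|]; rewrite mem_filter => /andP[_ /bmax].
move=> a Aa /h_fin[F [/finite_seqP[s ->] sA]].
apply: (main (size s)) => //; first by move=> c /sA[].
by apply/negP => /sA[_]; apply.
Qed.

Theorem theorem1 (K X : Type) (h : set X -> set X)
    (K_infinite : infinite_set [set: K])
    (X_succ : has_successor_card K X)
    (h_hull : hull_operator h)
    (h_finsupp : finite_supports h)
    (h_exchange : exchange_property h)
    (h_small : forall F : set X, finite_set F -> h F `\` h set0 #<= [set: K]) :
  exists I : K -> set X,
    (forall k : K, independent h (I k)) /\
    ~` h set0 `<=` \bigcup_(k in [set: K]) I k.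
Proof.
have [R [Rwo RK]] := @successor_well_order K {classic X} K_infinite X_succ.
pose Z x := hull_closure h ([set y | R y x] `\` h set0).
have ZK x : Z x #<= [set: K].
  apply: card_le_hull_closure => //.
  exact: card_le_trans (card_le_setD _ _) (RK x).
have Zmono x y : R x y -> Z x `<=` Z y.
  move=> xy; apply: hull_closure_mono => z [zx z0]; split=> //.
  exact: well_order_trans zx xy.
have /choice[f fI] : forall x, exists f : X -> K, {in Z x &, injective f}.
  elim/Ppointed: (K) K_infinite (ZK) => [K'|K' _ K'Z x].
    by rewrite emptyE => /(_ (finite_set0 _)).
  exact/pcard_injP/K'Z.
have /choice[r rP] : forall y, exists x, ~ h set0 y ->
    Z x y /\ forall w, Z w y -> R x w.
  move=> y; have [y0|y0] := pselect (h set0 y); first by exists y.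
  have [|x [[/asboolP Zx xmin] _]] := Rwo [pred x | `[< Z x y >]].
    exists y; apply/asboolP/sub_hull_closure; split=> //.
    exact: (well_order_refl Rwo).
  by exists x => _; split=> // w Zw; apply: xmin; apply/asboolP.
exists (fun k => [set y | ~ h set0 y /\ f (r y) y = k]); split; last first.
  by move=> y y0; exists (f (r y) y).
move=> k; apply: (independent_of_rank (r := r) Rwo) => //.
- move=> F w Ffin F0 Fw y hy y0; apply: (rP y y0).2.
  have FZ : F `<=` Z w.
    by move=> x Fx; apply: (Zmono (r x)) (rP x (F0 x Fx)).1; exact: Fw.
  by apply: (hull_closureP h_hull _ Ffin FZ) => // x [].
- by move=> y [].
- move=> x y /set_mem[x0 fx] /set_mem[y0 fy] rxy.
  rewrite -rxy -fx in fy; apply: (fI (r x)) (esym fy); apply/mem_set.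
    exact: (rP x x0).1.
  by rewrite rxy; exact: (rP y y0).1.
Qed.
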